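(* Let $G$ be a non-complete double-critical $k$-chromatic graph. Then no two vertices of degree $k+1$ are adjacent in $G$.
   Context: All graphs are finite and simple. A graph $G$ is (vertex-)critical if $\chi(G-v)<\chi(G)$ for every vertex $v\in V(G)$. A critical graph $G$ is double-critical if $\chi(G-x-y)\le\chi(G)-2$ for every edge $xy\in E(G)$. *)

(* Defs.v *)
From mathcomp Require Import all_boot.
Set Implicit Arguments. Unset Strict Implicit. Unset Printing Implicit Defensive.

Definition simple_graph (T : finType) (e : rel T) : Prop :=
  symmetric e /\ irreflexive e.

(* G[S] (the subgraph induced by S) has a proper colouring with colours in
   {0,...,k-1}.  Colours are drawn from 'I_(#|T|.+1), which loses nothing
   since at most #|T| colours are ever needed. *)
Definition colorable (T : finType) (e : rel T) (S : {set T}) (k : nat) : bool :=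
  [exists f : {ffun T -> 'I_(#|T|.+1)},
     [forall x in S, f x < k] &&
     [forall x in S, forall y in S, e x y ==> (f x != f y)]].

(* Chromatic number of G[S]: least k such that G[S] is k-colourable.
   For a loopless graph, k = #|T| always works, so this is the genuine
   minimum (searched in 0..#|T|). *)
Definition chi (T : finType) (e : rel T) (S : {set T}) : nat :=
  find (colorable e S) (iota 0 #|T|.+1).

Definition chiG (T : finType) (e : rel T) : nat := chi e [set: T].

Definition critical (T : finType) (e : rel T) : Prop :=
  forall v : T, chi e (~: [set v]) < chiG e.

Definition double_critical (T : finType) (e : rel T) : Prop :=
  critical e /\
  forall x y : T, e x y -> chi e (~: [set x; y]) <= chiG e - 2.

Definition complete (T : finType) (e : rel T) : Prop :=
  forall x y : T, x != y -> e x y.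

Definition degree (T : finType) (e : rel T) (v : T) : nat := #|[set w | e v w]|.

(* Main.v *)
Require Import Defs.
From mathcomp Require Import all_boot zify.
Set Implicit Arguments. Unset Strict Implicit. Unset Printing Implicit Defensive.

(** Let c be a (k-2)-colouring of G - x - y for an edge xy.  For every sequence
    of distinct colours there is an x-y path whose inner vertices carry these
    colours; otherwise x could be coloured by pushing the vertices in conflict
    from colour to colour, ending in one extra colour shared with y.  Paths with
    one inner vertex show that the common neighbours of x and y see all k-2
    colours.  Hence, if deg x = k+1, the complement H of G[N(x)] has all degrees
    0 or 2 and no triangle.  If moreover deg y = k+1, paths with two inner
    vertices make common neighbours adjacent as soon as their colours are not
    repeated in N(x) and N(y).  Deleting from N(x) a suitable vertex cover of H
    with three elements then leaves a clique which, together with x, has k-1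
    vertices.  This is impossible: if a clique Q on k-1 vertices met every edge,
    then every vertex outside Q could take the colour of a non-neighbour in Q,
    and otherwise an edge disjoint from Q contradicts double-criticality. *)

(** * Counting colours on a finite set *)

Lemma card_leq_of_onto (T : finType) (S : {set T}) (c : T -> nat) m :
  (forall j, j < m -> exists2 v, v \in S & c v = j) -> m <= #|S|.
Proof.
move=> onto; rewrite cardE -(size_iota 0 m) -(size_map c).
apply: uniq_leq_size (iota_uniq 0 m) _ => j.
rewrite mem_iota /= => /onto[v vS <-].
by rewrite map_f // mem_enum.
Qed.

(** If two points shared a value, one could be dropped and the rest of [S] would still hit all [m]
    values. *)
Lemma onto_inj (T : finType) (S : {set T}) (c : T -> nat) m :
  (forall j, j < m -> exists2 v, v \in S & c v = j) -> #|S| <= m ->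
  {in S &, injective c}.
Proof.
move=> onto leS u v uS vS cuv; apply: contraTeq leS => neq_uv.
rewrite -ltnNge (cardsD1 u S) uS ltnS.
apply: (@card_leq_of_onto _ _ c) => j /onto[w wS <-].
have [->|neq_wu] := eqVneq w u; last by exists w; rewrite // !inE neq_wu.
by exists v; rewrite // !inE eq_sym neq_uv.
Qed.

Lemma pigeonhole (T : finType) (S : {set T}) (c : T -> nat) m :
  (forall v, v \in S -> c v < m) -> m < #|S| ->
  exists u v, [/\ u \in S, v \in S, u != v & c u = c v].
Proof.
move=> c_lt ltS.
have /dinjectiveP ninj : ~~ dinjectiveb c (mem S).
  apply: contraTN ltS => /dinjectiveP c_inj; rewrite -leqNgt cardE.
  rewrite -(size_map c) -[X in _ <= X](size_iota 0 m); apply: uniq_leq_size.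
    rewrite map_inj_in_uniq ?enum_uniq // => u v; rewrite !mem_enum.
    exact: c_inj.
  by move=> j /mapP[v]; rewrite mem_enum mem_iota => /c_lt ? ->.
have [/existsP[u /existsP[v /and4P[uS vS neq /eqP cuv]]]|/existsPn no] :=
  boolP [exists u, exists v, [&& u \in S, v \in S, u != v & c u == c v]].
  by exists u, v.
case: ninj => u v uS vS cuv; apply/eqP; apply: contraT => neq.
by have /existsPn/(_ v) := no u; rewrite uS vS neq cuv eqxx.
Qed.

(** * Proper colourings and the chromatic number *)

Section Coloring.

Variables (T : finType) (e : rel T).
Hypothesis e_irr : irreflexive e.

Definition proper_coloring (S : {set T}) (m : nat) (f : T -> nat) : Prop :=
  (forall u, u \in S -> f u < m) /\
  (forall u v, u \in S -> v \in S -> e u v -> f u <> f v).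

Definition clique (Q : {set T}) : Prop :=
  forall u v, u \in Q -> v \in Q -> u != v -> e u v.

Lemma proper_coloring_rank S :
  proper_coloring S #|T| (fun u => nat_of_ord (enum_rank u)).
Proof.
split=> [u _|u v _ _ euv /val_inj/enum_rank_inj eq_uv]; first exact: ltn_ord.
by rewrite eq_uv e_irr in euv.
Qed.

Lemma colorableP S m :
  reflect (exists f, proper_coloring S m f) (colorable e S m).
Proof.
apply: (iffP existsP) => [[f /andP[/forall_inP f_lt /forall_inP f_proper]]|].
  exists (fun u => nat_of_ord (f u)); split=> // u v uS vS euv.
  have /forall_inP/(_ v vS)/implyP/(_ euv)/eqP neq := f_proper u uS.
  by move/val_inj.
case=> f; have [leTm _|lt_mT [f_lt f_proper]] := leqP #|T| m.
  (* For [m >= #|T|] the values of the given colouring may not fit into the ordinal type, so the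
     injective ranking replaces it. *)
  have [r_lt r_proper] := proper_coloring_rank S.
  exists [ffun u => inord (enum_rank u)]; apply/andP; split.
    apply/forall_inP => u uS; rewrite ffunE inordK.
      exact: leq_trans (r_lt u uS) leTm.
    exact: ltnW (r_lt u uS).
  apply/forall_inP => u uS; apply/forall_inP => v vS; apply/implyP => euv.
  rewrite !ffunE -val_eqE /= !inordK ?ltnS 1?ltnW //.
  exact/eqP/r_proper.
have f_small u : u \in S -> f u < #|T|.+1 by move/f_lt; lia.
exists [ffun u => inord (f u)]; apply/andP; split.
  by apply/forall_inP => u uS; rewrite ffunE inordK ?f_small ?f_lt.
apply/forall_inP => u uS; apply/forall_inP => v vS; apply/implyP => euv.
by rewrite !ffunE -val_eqE /= !inordK ?f_small //; apply/eqP/f_proper.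
Qed.

Lemma chi_leP S m :
  reflect (exists f, proper_coloring S m f) (chi e S <= m).
Proof.
have colT : colorable e S #|T|.
  by apply/colorableP; exists (fun u => nat_of_ord (enum_rank u)); apply: proper_coloring_rank.
have chi_col : colorable e S (chi e S).
  have has_col : has (colorable e S) (iota 0 #|T|.+1).
    by apply/hasP; exists #|T|; rewrite // mem_iota /=.
  have := nth_find 0 has_col; rewrite nth_iota //.
  by rewrite -[X in _ < X](size_iota 0) -has_find.
apply: (iffP idP) => [le_m|/colorableP col_m].
  have /colorableP[f [f_lt f_proper]] := chi_col.
  by exists f; split=> // u /f_lt lt; apply: leq_trans le_m.
rewrite leqNgt; apply/negP => lt_m.
have := before_find 0 lt_m; rewrite nth_iota ?col_m //.
by apply: leq_trans lt_m _; rewrite -[X in _ <= X](size_iota 0 #|T|.+1) find_size.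
Qed.

Lemma clique_leq_colors (S Q : {set T}) m f :
  clique Q -> Q \subset S -> proper_coloring S m f -> #|Q| <= m.
Proof.
move=> cliqueQ /subsetP subQS [f_lt f_proper]; rewrite leqNgt; apply/negP.
case/(pigeonhole (c := f)) => [v /subQS/f_lt //|u [v [uQ vQ neq fuv]]].
exact: f_proper (subQS u uQ) (subQS v vQ) (cliqueQ u v uQ vQ neq) fuv.
Qed.

End Coloring.

(** * Cliques in a non-complete double-critical graph *)

Section DoubleCritical.

Variables (T : finType) (e : rel T).
Hypotheses (e_sym : symmetric e) (e_irr : irreflexive e).
Hypotheses (e_ncomplete : ~ complete e) (e_dc : double_critical e).

Notation k := (chiG e).

Lemma chiG_min m f : proper_coloring e [set: T] m f -> k <= m.
Proof. by move=> f_col; apply/chi_leP => //; exists f. Qed.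

Lemma edge_neq u v : e u v -> u != v.
Proof. by apply: contraTneq => ->; rewrite e_irr. Qed.

Lemma neighbor_neq u v : e u v -> v != u.
Proof. by move/edge_neq; rewrite eq_sym. Qed.

Lemma clique_missing Q : clique e Q -> exists z, z \notin Q.
Proof.
move=> cliqueQ; have [/existsP //|/existsPn Q_all] := boolP [exists z, z \notin Q].
case: e_ncomplete => x y; apply: cliqueQ.
  by have := Q_all x; rewrite negbK.
by have := Q_all y; rewrite negbK.
Qed.

(** Some [z] lies outside the clique, and criticality colours [G - z], which contains the clique,
    with fewer than [k] colours. *)
Lemma clique_lt_chiG Q : clique e Q -> #|Q| < k.
Proof.
move=> cliqueQ; have [z zQ] := clique_missing cliqueQ.
apply: leq_ltn_trans (e_dc.1 z).
have /(chi_leP e_irr)[f f_col] := leqnn (chi e (~: [set z])).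
by apply: clique_leq_colors cliqueQ _ f_col; rewrite subsetC sub1set inE.
Qed.

Lemma edge_coloring x y : e x y ->
  exists c, proper_coloring e (~: [set x; y]) (k - 2) c.
Proof. by move=> /(e_dc.2)/(chi_leP e_irr). Qed.

Lemma clique2 x y : e x y -> clique e [set x; y].
Proof.
move=> exy u v; rewrite !inE.
by move=> /orP[]/eqP-> /orP[]/eqP->; rewrite ?eqxx // e_sym.
Qed.

Lemma chiG_gt2 x y : e x y -> 2 < k.
Proof.
by move=> exy; have := clique_lt_chiG (clique2 exy); rewrite cards2 edge_neq.
Qed.

Lemma cliqueU1 z Q : clique e Q -> {in Q, forall w, e z w} -> clique e (z |: Q).
Proof.
move=> cliqueQ zQ u v; rewrite !in_setU1 => /predU1P[->|uQ] /predU1P[->|vQ] neq.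
- by rewrite eqxx in neq.
- exact: zQ.
- by rewrite e_sym zQ.
- exact: cliqueQ.
Qed.

Lemma clique_lt_chiG_pred Q : clique e Q -> #|Q| < k - 1.
Proof.
move=> cliqueQ; rewrite ltnNge; apply/negP => leQ.
have ltQ := clique_lt_chiG cliqueQ.
have out_indep u v : u \notin Q -> v \notin Q -> ~~ e u v.
  move=> uQ vQ; apply/negP => euv; have [c c_col] := edge_coloring euv.
  have := clique_leq_colors cliqueQ _ c_col.
  rewrite subsetC subUset !sub1set !inE uQ vQ => /(_ isT).
  by have := chiG_gt2 euv; lia.
(* A vertex [z] adjacent to all of [Q] would extend it to a clique on [k] vertices, so the default
   of [odflt] is never reached outside [Q]. *)
have [q qP] : exists q, forall z, z \notin Q -> q z \in Q /\ ~~ e z (q z).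
  exists (fun z => odflt z [pick w in Q | ~~ e z w]) => z zQ.
  case: pickP => [w /andP[] //|none].
  have := clique_lt_chiG (Q := z |: Q); rewrite cardsU1 zQ => ltzQ.
  have /ltzQ : clique e (z |: Q); last by lia.
  by apply: cliqueU1 => // w wQ; have := none w; rewrite wQ => /negbFE.
pose r u := index (if u \in Q then u else q u) (enum Q).
have rep u : (if u \in Q then u else q u) \in enum Q.
  by rewrite mem_enum; case: ifP => // /negbT/qP[].
suff /chiG_min : proper_coloring e [set: T] #|Q| r by lia.
split=> [u _|u v _ _ euv]; first by rewrite cardE index_mem.
move=> /(index_inj u (rep u) (rep v)); case: ifPn => uQ; case: ifPn => vQ eq_uv.
- by rewrite eq_uv e_irr in euv.
- by have [_] := qP v vQ; rewrite -eq_uv e_sym euv.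
- by have [_] := qP u uQ; rewrite eq_uv euv.
- by have := out_indep u v uQ vQ; rewrite euv.
Qed.

(* If [X] and [y] are the uncoloured vertices, giving [X] the colour [i] and
   uncolouring [front X y c i] keeps the colouring proper. *)
Definition front (X : {set T}) y (c : T -> nat) i : {set T} :=
  [set v | [&& v \notin y |: X, c v == i & [exists u in X, e u v]]].

Definition shift (X : {set T}) (c : T -> nat) i : T -> nat :=
  fun u => if u \in X then i else c u.

Definition indep (X : {set T}) : Prop :=
  forall u v, u \in X -> v \in X -> ~~ e u v.

(** Otherwise [y |: X] is independent, and the single new colour [m] completes a colouring of [G]
    with fewer than [k] colours. *)
Lemma front_adj X y c m : indep X -> m.+1 < k ->
  proper_coloring e (~: (y |: X)) m c -> exists2 u, u \in X & e u y.
Proof.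
move=> indepX ltmk [c_lt c_proper].
have [/exists_inP //|/exists_inPn none] := boolP [exists u in X, e u y].
suff /chiG_min : proper_coloring e [set: T] m.+1
    (fun u => if u \in y |: X then m else c u) by lia.
have indepyX u v : u \in y |: X -> v \in y |: X -> ~~ e u v.
  rewrite !in_setU1 => /predU1P[->|uX] /predU1P[->|vX].
  - by rewrite e_irr.
  - by rewrite e_sym none.
  - exact: none.
  - exact: indepX.
split=> [u _|u v _ _ euv].
  by case: ifPn => // uX; rewrite ltnW // ltnS c_lt // in_setC.
case: ifPn => uX; case: ifPn => vX.
- by have := indepyX u v uX vX; rewrite euv.
- by have := c_lt v; rewrite in_setC vX => /(_ isT); lia.
- by have := c_lt u; rewrite in_setC uX => /(_ isT); lia.
- by have := c_proper u v; rewrite !in_setC uX vX; apply.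
Qed.

(** The front is monochromatic, hence independent; every vertex of colour [i] that could conflict
    with the recoloured [X] has been uncoloured. *)
Lemma front_shift X y c m i : i < m -> indep X ->
  proper_coloring e (~: (y |: X)) m c ->
  indep (front X y c i) /\
  proper_coloring e (~: (y |: front X y c i)) m (shift X c i).
Proof.
move=> ltim indepX [c_lt c_proper]; split.
  move=> u v /[!inE] /and3P[uX /eqP cu _] /and3P[vX /eqP cv _].
  by apply/negP => /c_proper; rewrite !inE cu cv; apply.
have new_front u v : u \in X -> v \notin X -> v \in ~: (y |: front X y c i) ->
    e u v -> i <> c v.
  move=> uX vX /[!inE] /norP[neq nfront] euv cv; case/negP: nfront.
  by rewrite (negPf neq) (negPf vX) -cv eqxx /=; apply/exists_inP; exists u.
have old u : u \notin X -> u \in ~: (y |: front X y c i) -> u \in ~: (y |: X).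
  by move=> uX; rewrite !inE (negPf uX) orbF => /norP[].
split=> [u uS|u v uS vS euv]; rewrite /shift.
  by case: ifPn => // uX; apply/c_lt/old.
case: ifPn => uX; case: ifPn => vX.
- by have := indepX u v uX vX; rewrite euv.
- exact: new_front vS euv.
- by apply/nesym/(new_front v) => //; rewrite e_sym.
- exact: c_proper (old u uX uS) (old v vX vS) euv.
Qed.

(** * Paths with prescribed colours between the ends of an edge *)

Section KempeChains.

Variables (x y : T) (c : T -> nat).
Hypotheses (exy : e x y) (c_col : proper_coloring e (~: [set x; y]) (k - 2) c).

Let start : indep [set x] /\ proper_coloring e (~: (y |: [set x])) (k - 2) c.
Proof.
split; last by rewrite setUC.
by move=> u v /set1P-> /set1P->; rewrite e_irr.
Qed.

Let lt_chi : (k - 2).+1 < k.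
Proof. by have := chiG_gt2 exy; lia. Qed.

Lemma common_neighbor i : i < k - 2 ->
  exists v, [/\ e x v, e y v & c v = i].
Proof.
move=> lti; have [indep0 col0] := start.
have [indep1 col1] := front_shift lti indep0 col0.
have [v] := front_adj indep1 lt_chi col1; rewrite inE.
case/and3P=> _ /eqP cv /exists_inP[u /set1P-> exv] evy.
by exists v; split; rewrite // e_sym.
Qed.

Lemma kempe_chain i j : i < k - 2 -> j < k - 2 -> i <> j ->
  exists u v, [/\ e x u, e u v, e y v, c u = i & c v = j]
              /\ (u != y /\ v != x).
Proof.
move=> lti ltj neq; have [indep0 col0] := start.
have [indep1 col1] := front_shift lti indep0 col0.
have [indep2 col2] := front_shift ltj indep1 col1.
have [v] := front_adj indep2 lt_chi col2; rewrite inE /shift.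
case/and3P=> _ cv /exists_inP[u]; rewrite inE.
case/and3P=> uyx /eqP cu /exists_inP[w /set1P-> exu] euv evy.
(* After the first push [x] itself has colour [i], so [v = x] would force [i = j]. *)
exists u, v; move: cv; case: ifPn => [_ /eqP //|vx /eqP cv].
split; first by split; rewrite // e_sym.
by move: uyx; rewrite !inE in vx * => /norP[].
Qed.

End KempeChains.

(* Adjacency in the complement of the subgraph induced by the neighbourhood of
   [x]. *)
Definition antiedge x u v := [&& e x u, e x v, u != v & ~~ e u v].

Lemma antiedgeC x u v : antiedge x u v = antiedge x v u.
Proof. by rewrite /antiedge [e v u]e_sym [v == u]eq_sym andbCA. Qed.

(** In a colouring of [G - x - u], take as [w] the common neighbour of [x] and [u] with the colour
    of [v]. Hence no vertex has exactly one antineighbour. *)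
Lemma antiedge_next x u v : antiedge x u v ->
  exists2 w, antiedge x v w & e u w.
Proof.
case/and4P=> exu exv neq neuv; have [c c_col] := edge_coloring exu.
have vS : v \in ~: [set x; u].
  by rewrite !inE negb_or eq_sym edge_neq // eq_sym neq.
have [w [exw euw cw]] := common_neighbor exu c_col (c_col.1 v vS).
exists w => //; rewrite /antiedge exv exw.
have neqvw : v != w by apply: contraNneq neuv => ->.
rewrite neqvw; apply/negP => /(c_col.2 _ _ vS); apply=> //.
by rewrite !inE negb_or ![w == _]eq_sym !edge_neq.
Qed.

(** * Antiedges at a vertex of degree [k + 1] *)

Section DegreeSucc.

Variable x : T.
Hypothesis deg_x : degree e x = k.+1.

(** With a third antineighbour, [z], its three antineighbours and the [k - 2] or more common
    neighbours of [x] and [z] would exceed the degree of [x]. *)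
Lemma antiedge_le2 z a b v : antiedge x z a -> antiedge x z b -> a != b ->
  antiedge x z v -> (v == a) || (v == b).
Proof.
case/and4P=> exz exa za neza /and4P[_ exb zb nezb] ab /and4P[_ exv zv nezv].
apply: contraT => /norP[va vb]; have [c c_col] := edge_coloring exz.
pose D := [set w | e x w & e z w].
have leD : k - 2 <= #|D|.
  apply: (@card_leq_of_onto _ _ c) => j.
  move=> /(common_neighbor exz c_col)[w [exw ezw cw]].
  by exists w; rewrite // inE exw.
have sub : z |: (a |: (b |: (v |: D))) \subset [set w | e x w].
  rewrite !subUset !sub1set !inE exz exa exb exv /=.
  by apply/subsetP => w; rewrite !inE => /andP[].
have := subset_leq_card sub; rewrite -/(degree e x) deg_x.
rewrite !cardsU1 !in_setU1 !inE e_irr (negPf za) (negPf zb) (negPf zv).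
rewrite (negPf ab) [a == v]eq_sym (negPf va) [b == v]eq_sym (negPf vb).
rewrite (negPf neza) (negPf nezb) (negPf nezv) !andbF /=.
by move: leD (chiG_gt2 exz); clear; lia.
Qed.

(** The second antineighbour of [v] given by [antiedge_next] is adjacent to [u], and it must be
    [w]. *)
Lemma antiedge_no_triangle u v w :
  antiedge x u v -> antiedge x v w -> antiedge x u w -> False.
Proof.
move=> uv vw uw; have [b vb eub] := antiedge_next uv.
rewrite antiedgeC in uv.
have := antiedge_le2 uv vb (edge_neq eub) vw.
case/and4P: uw => _ _ neq neuw; rewrite eq_sym (negPf neq) => /eqP eq_wb.
by rewrite eq_wb eub in neuw.
Qed.

End DegreeSucc.

Section AdjacentPair.

Variables (x y : T) (c : T -> nat).
Hypotheses (exy : e x y) (deg_x : degree e x = k.+1).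
Hypothesis c_col : proper_coloring e (~: [set x; y]) (k - 2) c.

Lemma antiedge_same_color u v : e x u -> e x v -> u != y -> v != y -> u != v ->
  c u = c v -> antiedge x u v.
Proof.
move=> exu exv uy vy neq cuv; rewrite /antiedge exu exv neq /=.
by apply/negP => /c_col.2; apply; rewrite // !inE negb_or neighbor_neq.
Qed.

(** The common neighbour with the colour of [a] is an antineighbour of [a] besides [y], and there
    are at most two. *)
Lemma private_partner a : antiedge x y a ->
  exists b, [/\ e x b, e y b, c b = c a &
                forall v, antiedge x a v -> (v == y) || (v == b)].
Proof.
move=> ya; case/and4P: (ya) => _ exa neya neya'.
have lta : c a < k - 2.
  by apply: c_col.1; rewrite !inE negb_or neighbor_neq // eq_sym.
have [b [exb eyb cb]] := common_neighbor exy c_col lta.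
exists b; split=> // v; rewrite antiedgeC in ya.
apply: antiedge_le2 => //; last exact: edge_neq.
apply: antiedge_same_color => //; first by rewrite eq_sym.
  exact: neighbor_neq.
by apply: contraNneq neya' => ->.
Qed.

End AdjacentPair.

(** * Two adjacent vertices of degree [k + 1] *)

Section AdjacentDegreeSucc.

Variables x y : T.
Hypotheses (exy : e x y).
Hypotheses (deg_x : degree e x = k.+1) (deg_y : degree e y = k.+1).

Let B := [set v | e x v & e y v].

Lemma no_private_neighbor a1 : antiedge x y a1 -> False.
Proof.
move=> ya1; have [c c_col] := edge_coloring exy.
have c_col' : proper_coloring e (~: [set y; x]) (k - 2) c by rewrite setUC.
have eyx : e y x by rewrite e_sym.
have [a2 ya2 ea12] : exists2 a2, antiedge x y a2 & e a1 a2.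
  by apply: antiedge_next; rewrite antiedgeC.
have a12 := edge_neq ea12.
have onto j : j < k - 2 -> exists2 v, v \in B & c v = j.
  move=> /(common_neighbor exy c_col)[v [exv eyv cv]].
  by exists v; rewrite // inE exv.
have leB := card_leq_of_onto onto.
(* Besides [B], [N(x)] contains [y], [a1] and [a2], which leaves at most [k - 2] vertices for the
   [k - 2] colours. *)
have c_inj : {in B &, injective c}.
  apply: onto_inj onto _.
  have sub : y |: (a1 |: (a2 |: B)) \subset [set w | e x w].
    case/and4P: ya1 ya2 => _ exa1 _ _ /and4P[_ exa2 _ _].
    rewrite !subUset !sub1set !inE exy exa1 exa2.
    by apply/subsetP => w; rewrite !inE => /andP[].
  have := subset_leq_card sub; rewrite -/(degree e x) deg_x.
  case/and4P: ya1 ya2 => _ _ yna1 nya1 /and4P[_ _ yna2 nya2].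
  rewrite !cardsU1 !in_setU1 !inE e_irr (negPf a12) (negPf yna1) (negPf yna2).
  by rewrite (negPf nya1) (negPf nya2) !andbF /=; clear; lia.
have [b1 [exb1 eyb1 cb1 a1_anti]] := private_partner exy deg_x c_col ya1.
have [b2 [exb2 eyb2 cb2 a2_anti]] := private_partner exy deg_x c_col ya2.
(* [y], [b1], [b2] cover all antiedges at [x]. *)
pose B' := B :\ b1 :\ b2.
have inB' v : v \in B' -> [/\ e x v, e y v, v != b1 & v != b2].
  by rewrite !inE => /and4P[].
have cliqueB' : clique e B'.
  move=> u v uB' vB' neq.
  have [exu eyu ub1 ub2] := inB' u uB'; have [exv eyv vb1 vb2] := inB' v vB'.
  have cuv : c u <> c v.
    by move/c_inj => /[!inE] eq_uv; rewrite eq_uv ?eqxx ?exu ?exv in neq.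
  have inS w : e x w -> e y w -> w \in ~: [set x; y].
    by move=> exw eyw; rewrite !inE negb_or !neighbor_neq.
  have ltu := c_col.1 u (inS u exu eyu); have ltv := c_col.1 v (inS v exv eyv).
  have [u' [v' [[exu' eu'v' eyv' cu' cv'] [u'y v'x]]]] :=
    kempe_chain exy c_col ltu ltv cuv.
  (* A private [u'] would be [a1] or [a2], whose colours occur in [B] only at [b1] and [b2]. *)
  have eq_u : u' = u.
    have [eyu'|neyu'] := boolP (e y u').
      by apply: c_inj; rewrite ?inE ?exu' ?exu.
    have /(antiedge_le2 deg_x ya1 ya2 a12) : antiedge x y u'.
      by rewrite /antiedge exy exu' eq_sym u'y.
    case/orP=> /eqP eq_u'.
      case/eqP: ub1; apply: c_inj; rewrite ?inE ?exu ?exb1 //.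
      by rewrite cb1 -cu' eq_u'.
    case/eqP: ub2; apply: c_inj; rewrite ?inE ?exu ?exb2 //.
    by rewrite cb2 -cu' eq_u'.
  (* Otherwise [v'] is a private neighbour of [y], antiadjacent to [v]; as [v] has
     antidegree 2 both at [x] and at [y], it is also antiadjacent to a private
     neighbour of [x], which forces [v] to be [b1] or [b2]. *)
  suff eq_v : v' = v by rewrite -eq_u -eq_v.
  have [exv'|nexv'] := boolP (e x v').
    by apply: c_inj; rewrite ?inE ?exv' ?exv.
  have xv' : antiedge y x v' by rewrite /antiedge eyx eyv' eq_sym v'x.
  have [d [eyd exd cd v'_anti]] := private_partner eyx deg_y c_col' xv'.
  have eq_d : d = v by apply: c_inj; rewrite ?inE ?exd ?exv // cd.
  have vv' : antiedge y v' v.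
    apply: (antiedge_same_color c_col') => //; first exact: neighbor_neq.
    by apply: contraNneq nexv' => ->.
  have [w vw ev'w] := antiedge_next vv'.
  case/and4P: (vw) => _ eyw neqvw nevw.
  have wx : w != x by apply: contraNneq nevw => ->; rewrite e_sym.
  (* If [w] were private to [y], its partner would be [v], so the adjacent [v'] and [w] would share
     the colour of [v]. *)
  have [exw|nexw] := boolP (e x w); last first.
    have xw : antiedge y x w by rewrite /antiedge eyx eyw eq_sym wx.
    have [f [eyf exf cf w_anti]] := private_partner eyx deg_y c_col' xw.
    rewrite antiedgeC in vw; have := w_anti v vw.
    rewrite (negPf (neighbor_neq exv)) /= => /eqP eq_f.
    case: (c_col.2 v' w _ _ ev'w); rewrite ?cv' ?eq_f // !inE negb_or.
      by rewrite v'x neighbor_neq.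
    by rewrite wx neighbor_neq.
  have [|b vb ewb] := @antiedge_next x w v.
    by rewrite /antiedge exw exv eq_sym neqvw e_sym.
  case/and4P: (vb) => _ exb neqvb nevb.
  (* Otherwise [v] would have three antineighbours [b], [w], [v'] at [y]. *)
  have neyb : ~~ e y b.
    apply/negP => eyb; have vb_y : antiedge y v b by apply/and4P.
    have := antiedge_le2 deg_y vb_y vw (neighbor_neq ewb).
    rewrite antiedgeC in vv' => /(_ _ vv') /orP[] /eqP eq_v'.
      by rewrite eq_v' exb in nexv'.
    by rewrite eq_v' e_irr in ev'w.
  have yb : antiedge x y b.
    rewrite /antiedge exy exb neyb andbT.
    by apply: contraNneq nevb => <-; rewrite e_sym.
  rewrite antiedgeC in vb.
  have vy := neighbor_neq eyv.
  case/orP: (antiedge_le2 deg_x ya1 ya2 a12 yb) vb => /eqP-> /=.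
    by move/a1_anti; rewrite (negPf vy) (negPf vb1).
  by move/a2_anti; rewrite (negPf vy) (negPf vb2).
case/and4P: ya1 ya2 => _ exa1 ya1 neya1 /and4P[_ exa2 ya2 neya2].
have a2_adj : {in B', forall v, e a2 v}.
  move=> v /inB'[exv eyv _ vb2]; apply: contraT => nea2v.
  have := a2_anti v; rewrite /antiedge exa2 exv nea2v (negPf vb2).
  rewrite (negPf (neighbor_neq eyv)) andbT; apply.
  by apply: contraNneq neya2 => ->.
have a1_adj : {in B', forall v, e a1 v}.
  move=> v /inB'[exv eyv vb1 _]; apply: contraT => nea1v.
  have := a1_anti v; rewrite /antiedge exa1 exv nea1v (negPf vb1).
  rewrite (negPf (neighbor_neq eyv)) andbT; apply.
  by apply: contraNneq neya1 => ->.
have /clique_lt_chiG_pred : clique e (x |: (a1 |: (a2 |: B'))).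
  apply: cliqueU1; first apply: cliqueU1; first exact: cliqueU1.
    by move=> v /setU1P[->|/a1_adj].
  by move=> v /setU1P[->|/setU1P[->|/inB'[]]].
(* The clique thus has at least [3 + (k - 2) - 2 = k - 1] vertices. *)
have leB' : #|B| <= 2 + #|B'|.
  rewrite (cardsD1 b1) (cardsD1 b2 (B :\ b1)) addnA leq_add2r.
  exact: leq_add (leq_b1 _) (leq_b1 _).
rewrite !cardsU1 !in_setU1 !inE e_irr (negPf a12) !(negPf neya1) !(negPf neya2).
rewrite (negPf (edge_neq exa1)) (negPf (edge_neq exa2)) !andbF /=.
by move: leB leB'; clear; lia.
Qed.

(** The [k] common neighbours carry only [k - 2] colours, so colours repeat on just two pairs, and
    every antiedge meets these four vertices. *)
Lemma closed_twins_false :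
  (forall v, ~~ antiedge x y v) -> (forall v, ~~ antiedge y x v) -> False.
Proof.
move=> xy_twin yx_twin; have [c c_col] := edge_coloring exy.
have inB v : e x v -> v != y -> v \in B.
  move=> exv vy; rewrite inE exv; have := xy_twin v.
  by rewrite /antiedge exy exv eq_sym vy negbK.
have inB' v : e y v -> v != x -> v \in B.
  move=> eyv vx; rewrite inE eyv andbT; have := yx_twin v.
  by rewrite /antiedge e_sym exy eyv eq_sym vx negbK.
have Bx v : v \in B -> e x v by rewrite inE => /andP[].
have By v : v \in B -> e y v by rewrite inE => /andP[].
have cardB : #|B| = k.
  have eqN : [set w | e x w] = y |: B.
    apply/setP => v; rewrite in_setU1; apply/idP/idP => [|/predU1P[->|/Bx]].
    - by rewrite inE => exv; case: eqP => //= /eqP /inB ->.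
    - by rewrite inE.
    - by rewrite inE.
  move: deg_x; rewrite /degree eqN cardsU1 inE e_irr andbF /=.
  by clear; lia.
have k_gt2 := chiG_gt2 exy.
have c_lt v : v \in B -> c v < k - 2.
  move=> vB; apply: c_col.1.
  by rewrite !inE negb_or !neighbor_neq ?Bx ?By.
have anti u v : u \in B -> v \in B -> u != v -> c u = c v -> antiedge x u v.
  move=> uB vB; apply: (antiedge_same_color c_col); rewrite ?Bx //.
    exact/neighbor_neq/By.
  exact/neighbor_neq/By.
have antiB u v : antiedge x u v -> v \in B.
  move=> uv; case/and4P: (uv) => _ exv _ _; apply: inB => //.
  by apply: contraNneq (xy_twin u) => <-; rewrite antiedgeC.
have [a1 [b1 [a1B b1B ab1 cab1]]] : exists a1 b1,
    [/\ a1 \in B, b1 \in B, a1 != b1 & c a1 = c b1].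
  by apply: pigeonhole c_lt _; rewrite cardB; move: k_gt2; clear; lia.
have [a2 [b2 [a2B' b2B' ab2 cab2]]] : exists a2 b2,
    [/\ a2 \in B :\ a1, b2 \in B :\ a1, a2 != b2 & c a2 = c b2].
  apply: (@pigeonhole _ _ _ (k - 2)) => [v /setD1P[_ /c_lt] //|].
  move: cardB k_gt2; rewrite (cardsD1 a1) a1B /=.
  by clear; lia.
have [a2a1 a2B] := setD1P a2B'; have [b2a1 b2B] := setD1P b2B'.
(* Equal colours would make [a1], [a2], [b2] a triangle of antiedges. *)
have ca12 : c a1 <> c a2.
  move=> ca12; apply: (@antiedge_no_triangle x deg_x a1 a2 b2).
  - by apply: anti; rewrite // eq_sym.
  - exact: anti.
  - by apply: anti; rewrite // ?ca12 // eq_sym.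
pose R := B :\ a1 :\ a2.
have cardR : #|R| <= k - 2.
  move: cardB; rewrite (cardsD1 a1) a1B (cardsD1 a2 (B :\ a1)) a2B' -/R /=.
  by clear; lia.
have b1R : b1 \in R.
  rewrite !in_setD1 b1B [b1 == a1]eq_sym ab1 !andbT.
  by apply/eqP => eq_ab; apply: ca12; rewrite cab1 eq_ab.
have b2R : b2 \in R by rewrite in_setD1 b2B' eq_sym ab2.
(* All [k - 2] colours survive in [R], since [b1] and [b2] stand in for [a1] and [a2]. *)
have c_injR : {in R &, injective c}.
  apply: onto_inj cardR => j /(common_neighbor exy c_col)[v [exv eyv cv]].
  have vB : v \in B by rewrite inE exv.
  have [eq_v|va1] := eqVneq v a1.
    by exists b1; rewrite // -cab1 -eq_v.
  have [eq_v2|va2] := eqVneq v a2.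
    by exists b2; rewrite // -cab2 -eq_v2.
  by exists v; rewrite // !in_setD1 va1 va2.
pose F := [:: a1; b1; a2; b2].
have c_unique u v : u \in B -> u \notin F -> v \in B -> c v = c u -> v = u.
  move=> uB + vB cvu; rewrite !inE => /norP[ua1 /norP[ub1 /norP[ua2 ub2]]].
  have uR : u \in R by rewrite !in_setD1 ua1 ua2.
  have [eq_v|va1] := eqVneq v a1.
    case/eqP: ub1; apply: c_injR => //.
    by rewrite -cab1 -eq_v cvu.
  have [eq_v2|va2] := eqVneq v a2.
    case/eqP: ub2; apply: c_injR => //.
    by rewrite -cab2 -eq_v2 cvu.
  by apply: c_injR; rewrite // !in_setD1 va1 va2 vB.
(* For two vertices whose colours are unique in [B], the path from [kempe_chain] must run through
   them, so they are adjacent. *)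
have hit u v : antiedge x u v -> u \notin F -> v \in F.
  move=> uv uF; apply: contraT => vF.
  have vB := antiB u v uv; have uB : u \in B by apply: (antiB v); rewrite antiedgeC.
  case/and4P: uv => _ _ neq; case/negP.
  have cuv : c u <> c v by move/c_unique => eq_uv; rewrite eq_uv ?eqxx in neq.
  have [u' [v' [[exu' eu'v' eyv' cu' cv'] [u'y v'x]]]] :=
    kempe_chain exy c_col (c_lt u uB) (c_lt v vB) cuv.
  have <- := c_unique u u' uB uF (inB u' exu' u'y) cu'.
  by have <- := c_unique v v' vB vF (inB' v' eyv' v'x) cv'.
have a1b1 : antiedge x a1 b1 by apply: anti.
have [s a1s eb1s] : exists2 s, antiedge x a1 s & e b1 s.
  by apply: antiedge_next; rewrite antiedgeC.
have b1s := edge_neq eb1s.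
have a2b2 : antiedge x a2 b2 by apply: anti.
have sa1 : s != a1 by case/and4P: a1s; rewrite eq_sym.
(* [b1], [q], [s] cover all antiedges at [x]. *)
have [q' [q [qq' qs perm_q s_q']]] : exists q' q, [/\ antiedge x q' q, q != s,
    F =i [:: a1; b1; q'; q] & (s == q') || antiedge x s q'].
  have F_swap : F =i [:: a1; b1; b2; a2].
    by move=> v; rewrite !inE [(v == a2) || _]orbC.
  have [eq_s|sa2] := eqVneq s a2; first by exists a2, b2; rewrite eq_s eqxx eq_sym.
  have [eq_s|sb2] := eqVneq s b2.
    by exists b2, a2; rewrite eq_s eqxx antiedgeC.
  (* Here [s] lies outside [F], so its antineighbour [t] lies in [F]; only [a2] and [b2] are
     possible, and [q'] is chosen to be [t]. *)
  have [t st ea1t] := antiedge_next a1s.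
  have := hit s t st; rewrite !inE (negPf sa1) [s == b1]eq_sym (negPf b1s).
  rewrite (negPf sa2) (negPf sb2) (negPf (neighbor_neq ea1t)) /= => /(_ isT).
  case/or3P=> /eqP eq_t; last 2 first.
  - by exists a2, b2; rewrite -eq_t st orbT eq_t [b2 == s]eq_sym.
  - by exists b2, a2; rewrite -eq_t st orbT antiedgeC eq_t [a2 == s]eq_sym.
  by case/and4P: st => _ _ _; rewrite eq_t e_sym eb1s.
pose B' := B :\ b1 :\ q :\ s.
have cliqueB' : clique e B'.
  (* The antineighbours of [a1] are [b1] and [s]; those of [q'] are [q] and [s], unless [q' = s].
     All of these have been removed. *)
  have noF u v : u \in B' -> v \in B' -> antiedge x u v -> u \notin F.
    rewrite perm_q !inE => /and4P[us uq ub1 _] /and4P[vs vq vb1 _] uv.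
    rewrite (negPf ub1) (negPf uq) orbF /=; apply/norP; split.
      apply: contraTneq uv => ->; apply/negP => /(antiedge_le2 deg_x a1b1 a1s b1s).
      by rewrite (negPf vb1) (negPf vs).
    apply/eqP => eq_u; rewrite eq_u in uv us.
    rewrite eq_sym (negPf us) antiedgeC /= in s_q'.
    have := antiedge_le2 deg_x qq' s_q' qs uv.
    by rewrite (negPf vq) (negPf vs).
  move=> u v uB' vB' neq; apply: contraT => neuv.
  have uv : antiedge x u v.
    move: uB' vB'; rewrite /antiedge !inE neq neuv.
    by case/and5P=> _ _ _ -> _ /and5P[_ _ _ ->].
  have uF := noF u v uB' vB' uv; have := hit u v uv uF.
  by rewrite antiedgeC in uv; rewrite (negPf (noF v u vB' uB' uv)).
have /clique_lt_chiG_pred : clique e (x |: (y |: B')).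
  apply: cliqueU1; first apply: cliqueU1 => //.
    by move=> v; rewrite !inE => /and5P[].
  by move=> v /setU1P[->|] //; rewrite !inE => /and5P[].
(* The clique has at least [2 + (k - 3) = k - 1] vertices. *)
have leB' : #|B| <= 3 + #|B'|.
  rewrite (cardsD1 b1) (cardsD1 q (B :\ b1)) (cardsD1 s (B :\ b1 :\ q)) !addnA.
  by rewrite leq_add2r (leq_add (leq_add (leq_b1 _) (leq_b1 _)) (leq_b1 _)).
rewrite !cardsU1 !in_setU1 !inE !e_irr (negPf (edge_neq exy)) !andbF /=.
by move: leB'; rewrite cardB; clear; lia.
Qed.

End AdjacentDegreeSucc.

End DoubleCritical.

Theorem theorem15 (T : finType) (e : rel T) (k : nat) :
  simple_graph e ->
  ~ complete e ->
  double_critical e ->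
  chiG e = k ->
  forall x y : T, e x y -> degree e x = k.+1 -> degree e y = k.+1 -> False.
Proof.
move=> [e_sym e_irr] e_ncomplete e_dc <- x y exy deg_x deg_y.
have eyx : e y x by rewrite e_sym.
apply: (closed_twins_false e_sym e_irr e_ncomplete e_dc exy deg_x) => v;
  apply/negP.
  exact: (no_private_neighbor e_sym e_irr e_ncomplete e_dc exy deg_x deg_y).
exact: (no_private_neighbor e_sym e_irr e_ncomplete e_dc eyx deg_y deg_x).
Qed.
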